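(* Let $E$ be an infinite-dimensional reflexive real Banach space, $T:E\to E$ a non-zero compact linear operator, $\varphi:E\to\mathbb{R}$ a lower semicontinuous, convex and coercive functional, $I\subset\mathbb{R}$ a compact interval with $0\in I$, and $\psi:I\to\mathbb{R}$ a lower semicontinuous convex function. Then, for each $r>\varphi(0)$, one has $$\sup_{x\in X}\inf_{\lambda\in I}\bigl(\varphi(T(x)-\lambda x)+\psi(\lambda)\bigr)=r+\psi(0),$$ where $$X=\{x\in E:\varphi(T(x))\leq r\}.$$
   Context: A functional $\varphi$ on a real normed space is coercive if $\lim_{\|x\|\to+\infty}\varphi(x)=+\infty$. Lower semicontinuity of $\varphi$ is with respect to the norm topology of $E$. *)

(* Defs.v *)
From HB Require Import structures.
From mathcomp Require Import all_boot all_order all_algebra.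
From mathcomp Require Import all_classical all_reals all_analysis.
Set Implicit Arguments.
Unset Strict Implicit.
Unset Printing Implicit Defensive.
Import Order.TTheory GRing.Theory Num.Theory.
Import numFieldNormedType.Exports.
Local Open Scope classical_set_scope.
Local Open Scope ring_scope.

Section dual.
Context (R : realType) (E : normedModType R).

Definition is_dual : {pred E -> R^o} :=
  [pred f : E -> R^o | `[< linear f /\ continuous f >]].

Lemma is_dualP (f : E -> R^o) :
  reflect (linear f /\ continuous f) (f \in is_dual).
Proof. by apply: (iffP idP) => [/asboolP|/asboolP]. Qed.

Lemma is_dual_submod_closed : submod_closed is_dual.
Proof.
split.
  apply/is_dualP; split; last exact: cst_continuous.
  by move=> a x y; rewrite /GRing.zero /= scaler0 addr0.
move=> a f g /is_dualP[lf cf] /is_dualP[lg cg]; apply/is_dualP; split.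
  by move=> b x y; rewrite !fctE lf lg !scalerDr !scalerA [a * b]mulrC addrACA.
by move=> x; apply: cvgD; [apply: cvgZl_tmp; exact: cf|exact: cg].
Qed.

HB.instance Definition _ :=
  GRing.isSubmodClosed.Build R (E -> R^o) is_dual is_dual_submod_closed.

Record dual := Dual { dual_fun :> E -> R^o ; _ : dual_fun \in is_dual }.

HB.instance Definition _ := [isSub for dual_fun].
HB.instance Definition _ := [Choice of dual by <:].
HB.instance Definition _ := [SubChoice_isSubLmodule of dual by <:].

Implicit Types f g : dual.

Lemma dual_linear f : linear f.
Proof. by case: f => f /= /is_dualP[]. Qed.

Lemma dual_continuous f : continuous (f : E -> R^o).
Proof. by case: f => f /= /is_dualP[]. Qed.

HB.instance Definition _ f :=
  GRing.isLinear.Build R E R^o *:%R (dual_fun f) (dual_linear f).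

Definition dual_norm f : R := sup [set `|f x| | x in [set x : E | `|x| <= 1]].

Lemma dual_norm_has_sup f :
  has_sup [set `|f x| | x in [set x : E | `|x| <= 1]].
Proof.
split; first by exists `|f 0|; exists 0 => //=; rewrite normr0.
have /bounded_funP/(_ 1)[M fM] : bounded_near f (nbhs (0 : E)).
  by apply/linear_bounded_continuous; exact: dual_continuous.
by exists M => _ [x /= x1 <-]; exact: fM.
Qed.

Lemma dual_norm_ub f x : `|x| <= 1 -> `|f x| <= dual_norm f.
Proof. by move=> x1; apply: ub_le_sup; [case: (dual_norm_has_sup f)|exists x]. Qed.

Lemma dual_norm_le f M :
  (forall x, `|x| <= 1 -> `|f x| <= M) -> dual_norm f <= M.
Proof.
move=> fM; apply: ge_sup; first by case: (dual_norm_has_sup f).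
by move=> _ [x /= x1 <-]; exact: fM.
Qed.

Lemma dual_normD f g : dual_norm (f + g) <= dual_norm f + dual_norm g.
Proof.
apply: dual_norm_le => x x1; rewrite (le_trans (ler_normD _ _))//.
by rewrite lerD// dual_norm_ub.
Qed.

Lemma dual_norm_ge0 f : 0 <= dual_norm f.
Proof. by apply: le_trans (normr_ge0 (f 0)) (dual_norm_ub _ _); rewrite normr0. Qed.

Lemma dual_normZ_le (a : R) f : dual_norm (a *: f) <= `|a| * dual_norm f.
Proof.
apply: dual_norm_le => x x1; rewrite [X in `|X|](_ : _ = a *: f x)//.
by rewrite normrZ ler_wpM2l// dual_norm_ub.
Qed.

Lemma dual_normZ (a : R) f : dual_norm (a *: f) = `|a| * dual_norm f.
Proof.
apply/eqP; rewrite eq_le dual_normZ_le/=.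
have [->|a0] := eqVneq a 0; first by rewrite normr0 mul0r dual_norm_ge0.
rewrite -ler_pdivlMl ?normr_gt0// -normfV.
by apply: le_trans (dual_normZ_le _ _); rewrite scalerA mulVf// scale1r.
Qed.

Lemma dual_norm0_eq0 f : dual_norm f = 0 -> f = 0.
Proof.
move=> f0; apply/val_inj/funext => x /=; apply/eqP; rewrite -normr_le0.
have [->|x0] := eqVneq x 0; first by rewrite linear0 normr0.
have : `|f (`|x|^-1 *: x)| <= 0.
  by rewrite -f0 dual_norm_ub// normrZ normfV normr_id mulVf// normr_eq0.
by rewrite linearZ/= normrZ pmulr_rle0// normr_gt0 invr_eq0 normr_eq0.
Qed.

HB.instance Definition _ := Lmodule_isNormed.Build R dual
  dual_normD dual_normZ dual_norm0_eq0.

End dual.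

(* Surjectivity of the canonical embedding of E into its bidual. *)
Definition reflexive_space (R : realType) (E : normedModType R) :=
  forall Phi : dual (dual E), exists x : E, forall f : dual E, Phi f = f x.

Definition infinite_dimensional (R : realType) (E : normedModType R) :=
  ~ exists (n : nat) (e : 'I_n -> E),
      forall x : E, exists c : 'I_n -> R, x = \sum_(i < n) c i *: e i.

(* [precompact] is relative compactness (compact closure), not total boundedness. *)
Definition compact_operator (R : realType) (E F : normedModType R)
    (T : {linear E -> F}) :=
  forall B : set E, bounded_set B -> precompact (T @` B).

(* The filter on E is the one of neighbourhoods of infinity in norm. *)
Definition coercive (R : realType) (E : normedModType R) (phi : E -> R) :=
  phi @ filter_from [set: R] (fun K => [set x : E | K < `|x|]) --> +oo.

(* Main.v *)
From HB Require Import structures.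
Require Import Defs.
From mathcomp Require Import all_boot all_order all_algebra.
From mathcomp Require Import all_classical all_reals all_analysis.
From mathcomp Require Import finmap ring lra.
Import Order.TTheory GRing.Theory Num.Theory.
Import numFieldNormedType.Exports.
Local Open Scope classical_set_scope.
Local Open Scope ring_scope.

(** The upper bound is the value at [l = 0].  For the lower bound, fix a small
    [e > 0] and look for a point [x] of [X] at which every [l] in [I] gives a
    value of at least [r + psi 0 - e].

    Along the line spanned by some [T x1 != 0], [phi] goes continuously from
    [phi 0 < r] to [+oo], so there is [x0] with [phi (T x0)] slightly below
    [r].  Let [p] be a subgradient of [phi] at [T x0].  The point is
    [x = x0 + s *: u] with [u] a unit vector, [p u = 0] and [p (T u) = 0], [s]
    large, and [T u] so small, depending on [s], that [s *: T u] is negligible.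
    Then [T x] is close to [T x0], hence [phi (T x) <= r] by continuity.
    If [|l|] is not small, then [T x - l *: x] is very far from the origin, so
    coercivity makes [phi] huge while [psi] is bounded below on [I].  If [|l|]
    is small, the subgradient inequality at
    [T x - l *: x = T x0 + (s *: T u - l *: (x0 + s *: u))] reads
    [phi (T x - l *: x) >= phi (T x0) - l * p x0]: neither the large [s] nor
    [T u] occurs in it, because [p] vanishes at [u] and at [T u]; and [psi l]
    is almost [psi 0] by semicontinuity.

    Such a [u] exists because a compact operator is not bounded below on an
    infinite-dimensional subspace (lemma [compact_operator_small]), and the
    common kernel of [p] and [p \o T] has finite codimension
    (lemma [finitely_spanned_ker]).  Continuity of [phi] comes from Baire's
    theorem (lemmas [lsc_bounded_ball] and [convex_bounded_ball_usc]), the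
    subgradient from Zorn's lemma (lemma [linear_minorant]).  The subgradient
    is used only through its values at [x0], [u] and [T u], so a purely
    algebraic linear form is enough. *)

Set Implicit Arguments.
Unset Strict Implicit.
Unset Printing Implicit Defensive.

(** * Linear minorants of convex functions *)

Lemma convex_functionTP (R : realType) (E : lmodType R) (f : E -> R) :
  convex_function [set: E] f <->
  forall (t : R) (x y : E), 0 <= t <= 1 ->
    f (t *: x + (1 - t) *: y) <= t * f x + (1 - t) * f y.
Proof.
split=> [cf t x y t01|cf t x y _ _].
  have t01' : Itv.spec (@Itv.num_sem R) (Itv.Real `[0, 1]%Z) t.
    by apply/andP; split; rewrite ?num_real// in_itv/=.
  by have := cf (Itv.mk t01') x y (in_setT _) (in_setT _).
by apply: (cf t%:inum x y); rewrite ge0 le1.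
Qed.

(** Zorn's lemma for the reversed pointwise order: the pointwise infimum of a
    chain is again convex, because two members of a chain can be replaced by
    the smaller one, and it is finite, because convexity and the value at [0]
    force [f x >= - f (- x) >= - q (- x)]. *)
Lemma minimal_convex_minorant (R : realType) (E : lmodType R) (q : E -> R) :
  convex_function [set: E] q -> q 0 = 0 ->
  exists p : E -> R, [/\ convex_function [set: E] p, p 0 = 0,
    forall x, p x <= q x &
    forall f : E -> R, convex_function [set: E] f -> f 0 = 0 ->
      (forall x, f x <= p x) -> f = p].
Proof.
move=> cq q0.
pose P (f : E -> R) :=
  [/\ convex_function [set: E] f, f 0 = 0 & forall x, f x <= q x].
pose below (f g : {f | P f}) := `[< forall x, sval g x <= sval f x >].
have bd (f : {f | P f}) x : - q (- x) <= sval f x.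
  case: f => f [/= /convex_functionTP cf f0 fq].
  have /(cf _ x (- x)) : 0 <= (2^-1 : R) <= 1 by lra.
  rewrite (_ : 1 - 2^-1 = 2^-1 :> R); last by lra.
  by rewrite scalerN subrr f0; have := fq (- x); lra.
have chain A : total_on A below -> exists g, forall f, A f -> below f g.
  move=> totA.
  have [[f0 Af0]|A0] := pselect (A !=set0); last first.
    have Pq : P q by split.
    by exists (exist _ q Pq) => f Af; case: A0; exists f.
  pose S x := [set sval f x | f in A].
  have hS x : has_inf (S x).
    by split; [exists (sval f0 x), f0|exists (- q (- x)) => _ [f _ <-]; exact: bd].
  have infS f x : A f -> inf (S x) <= sval f x.
    by move=> Af; apply: ge_inf; [case: (hS x)|exists f].
  have Pinf : P (fun x => inf (S x)).
    split.
    - apply/convex_functionTP => t x y t01; apply/ler_addgt0Pr => e e0.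
      have [_ [f Af <-] fx] := inf_adherent e0 (hS x).
      have [_ [g Ag <-] gy] := inf_adherent e0 (hS y).
      have [k Ak [kf kg]] : exists2 k, A k &
          sval k x <= sval f x /\ sval k y <= sval g y.
        by have [/asboolP fg|/asboolP gf] := totA f g Af Ag; [exists g|exists f].
      apply: le_trans (infS k _ Ak) _.
      case: (svalP k) => /convex_functionTP/(_ t x y t01) ck _ _.
      apply: le_trans ck _; nra.
    - rewrite (_ : S 0 = [set 0]) ?inf1//; apply/seteqP; split => [_ [f _ <-]|_ ->].
        by case: (svalP f).
      by exists f0 => //; case: (svalP f0).
    - by move=> x; apply: le_trans (infS f0 x Af0) _; case: (svalP f0).
  by exists (exist _ _ Pinf) => f Af; apply/asboolP => x; exact: infS.
have Pq : P q by split.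
have [] := @ZL_preorder _ (exist _ q Pq) below _ _ chain.
- by move=> f; apply/asboolP.
- move=> f g h /asboolP fg /asboolP gh; apply/asboolP => x.
  exact: le_trans (gh x) (fg x).
move=> [p [cp p0 pq]] pmin; exists p; split => // f cf f0 fp.
have Pf : P f by split => // x; exact: le_trans (fp x) (pq x).
have /asboolP /= pf : below (exist _ f Pf) (exist _ p (And3 cp p0 pq)).
  by apply: pmin; apply/asboolP.
by apply/funext => x; apply/eqP; rewrite eq_le fp pf.
Qed.

(** A minimal convex minorant [p] is linear.  For [0 < s <= 1] the function
    [fun x => s^-1 * p (s *: x)] is convex and lies below [p], so it is [p];
    hence [p] is positively homogeneous and therefore subadditive.  Then
    [fun x => p (x + y) - p y] is convex and lies below [p], so it is [p];
    hence [p] is additive. *)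
Lemma linear_minorant (R : realType) (E : lmodType R) (q : E -> R) :
  convex_function [set: E] q -> q 0 = 0 ->
  exists p : {linear E -> R^o}, forall x, p x <= q x.
Proof.
move=> cq q0; have [p [cp p0 pq pmin]] := @minimal_convex_minorant R E q cq q0.
have := cp => /convex_functionTP cvp.
have pZ_le1 (s : R) x : 0 < s -> s <= 1 -> p (s *: x) = s * p x.
  move=> s0 s1.
  rewrite -[in RHS](pmin (fun x => s^-1 * p (s *: x))).
  - by rewrite mulrA divff ?mul1r// gt_eqF.
  - apply/convex_functionTP => t y z t01.
    rewrite mulrCA [X in _ <= _ + X]mulrCA -mulrDr.
    apply: ler_wpM2l; first by rewrite invr_ge0 ltW.
    rewrite scalerDr !scalerA (mulrC s) (mulrC s) -!scalerA.
    exact: cvp.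
  - by rewrite scaler0 p0 mulr0.
  - move=> y; rewrite ler_pdivrMl//.
    have := @cvp s y 0; rewrite scaler0 addr0 p0 mulr0 addr0.
    by apply; rewrite ltW.
have pZ_gt0 (s : R) x : 0 < s -> p (s *: x) = s * p x.
  move=> s0; have [s1|/ltW s1] := leP s 1; first exact: pZ_le1.
  have := @pZ_le1 s^-1 (s *: x); rewrite invr_gt0 s0 invf_le1// s1.
  rewrite scalerA mulVf ?gt_eqF// scale1r => -> //.
  by rewrite mulrA divff ?mul1r// gt_eqF.
have pD_le x y : p (x + y) <= p x + p y.
  have /(cvp _ (2 *: x) (2 *: y)) : 0 <= (2^-1 : R) <= 1 by lra.
  rewrite (_ : 1 - 2^-1 = 2^-1 :> R); last by lra.
  rewrite !scalerA mulVf// !scale1r !pZ_gt0//; lra.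
have pD x y : p (x + y) = p x + p y.
  suff /(congr1 (@^~ x))/= <- : (fun x => p (x + y) - p y) = p by rewrite subrK.
  apply: pmin.
  - apply/convex_functionTP => t a b t01.
    rewrite (_ : _ + y = t *: (a + y) + (1 - t) *: (b + y)).
      by have := cvp t (a + y) (b + y) t01; lra.
    rewrite !scalerDr addrACA; congr +%R.
    by rewrite -scalerDl addrC subrK scale1r.
  - by rewrite add0r subrr.
  - by move=> a; rewrite lerBlDr.
have pN x : p (- x) = - p x.
  by apply/eqP; rewrite -addr_eq0 -pD addNr p0.
have plin : linear (p : E -> R^o).
  move=> s x y; rewrite pD; congr (_ + _).
  have [s0|s0|->] := ltgtP s 0.
  - rewrite -[s in LHS]opprK scaleNr pN pZ_gt0 ?oppr_gt0//.
    by rewrite mulNr opprK.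
  - exact: pZ_gt0.
  - by rewrite !scale0r p0.
pose m := GRing.isLinear.Build R E R^o *:%R p plin.
pose pl : {linear E -> R^o} := HB.pack (p : E -> R^o) m.
by exists pl.
Qed.

(** * Compact operators on infinite-dimensional subspaces *)

(** Only an inclusion in the span is required, so the vectors [e i] need not
    belong to [V]: the notion is used for subspaces and their kernels. *)
Definition finitely_spanned (R : realType) (E : lmodType R) (V : set E) :=
  exists (n : nat) (e : 'I_n -> E),
    forall x, V x -> exists c : 'I_n -> R, x = \sum_(i < n) c i *: e i.

Lemma finitely_spanned_ker (R : realType) (E : lmodType R) (V : set E)
    (p : {linear E -> R^o}) :
  (forall a x y, V x -> V y -> V (a *: x + y)) ->
  finitely_spanned (V `&` [set x | p x = 0]) -> finitely_spanned V.
Proof.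
move=> Vlin [n [e eV]].
have [Vp|/existsNP[a /not_implyP[Va /eqP pa]]] :=
    pselect (forall x, V x -> p x = 0).
  by exists n, e => x Vx; apply: eV; split => //; exact: Vp.
exists n.+1, (fun i => if unlift ord0 i is Some j then e j else a) => x Vx.
have [|c xc] := eV (- (p x / p a) *: a + x).
  split; first exact: Vlin.
  by rewrite /= linearD linearZ/= /GRing.scale/= mulNr divfK// addNr.
exists (fun i => if unlift ord0 i is Some j then c j else p x / p a).
rewrite big_ord_recl unlift_none.
under eq_bigr do rewrite liftK.
by rewrite -xc scaleNr addrA subrr add0r.
Qed.

(** Riesz's theorem, in a form that avoids the closedness of finite-dimensional
    subspaces.  Approximating [v] by [g v] in the net [s], then the rescaled
    error [2 *: (v - g v)] by an element of [s], and so on, gives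
    [v = \sum_k 2^-1 ^+ k *: g (u k)].  All terms are multiples of the finitely
    many elements of [s]; grouping them writes [v] as a combination of elements
    of [s], whose coefficients are sums of series dominated by a geometric one. *)
Lemma half_net_finitely_spanned (R : realType) (E : normedModType R)
    (V : set E) (s : seq E) :
  (forall a x y, V x -> V y -> V (a *: x + y)) ->
  (forall v, V v -> `|v| <= 1 ->
    exists f, [/\ f \in s, V f & `|v - f| <= 2^-1]) ->
  finitely_spanned V.
Proof.
move=> Vlin cov.
pose S := undup s; pose e (i : 'I_(size S)) := S`_i.
suff ball_span v : V v -> `|v| <= 1 ->
    exists c : 'I_(size S) -> R, v = \sum_i c i *: e i.
  exists (size S), e => x Vx.
  have [->|x0] := eqVneq x 0.
    by exists (fun=> 0); rewrite big1// => i _; rewrite scale0r.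
  have V0 : V 0 by rewrite -(addNr x) -scaleN1r; exact: Vlin.
  have [||c xc] := ball_span (`|x|^-1 *: x).
  - by rewrite -[_ *: x]addr0; exact: Vlin.
  - by rewrite normrZ normfV normr_id mulVf// normr_eq0.
  exists (fun i => `|x| * c i); under eq_bigr do rewrite -scalerA.
  by rewrite -scaler_sumr -xc scalerA divff ?scale1r// normr_eq0.
move=> Vv v1.
have /choice[g gP] : forall w, exists f, V w -> `|w| <= 1 ->
    [/\ f \in s, V f & `|w - f| <= 2^-1].
  move=> w; have [[Vw w1]|nVw] := pselect (V w /\ `|w| <= 1).
    by have [f fP] := cov w Vw w1; exists f.
  by exists 0 => Vw w1; case: nVw.
pose u k := iter k (fun w => 2 *: (w - g w)) v.
have uS k : u k.+1 = 2 *: (u k - g (u k)) by [].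
have uP k : V (u k) /\ `|u k| <= 1.
  elim: k => [//|k [Vu u1]]; have [_ Vg gu] := gP _ Vu u1; split.
    rewrite uS -[_ *: _]addr0 addrC [_ - _]addrC -scaleN1r addrC.
    have V0 : V 0 by rewrite -(addNr v) -scaleN1r; exact: Vlin.
    by apply: (Vlin) => //; exact: Vlin.
  by rewrite uS normrZ ger0_norm//; lra.
pose d i : R ^nat := fun k => 2^-1 ^+ k * (g (u k) == e i)%:R.
have partial n : v = \sum_i series (d i) n *: e i + 2^-1 ^+ n *: u n.
  elim: n => [|n IH].
    rewrite big1 ?add0r ?expr0 ?scale1r// => i _.
    by rewrite /series/= big_geq// scale0r.
  under eq_bigr do rewrite seriesSr scalerDl.
  rewrite big_split [v in LHS]IH -addrA; congr (_ + _).
  have [Vu u1] := uP n; have [gs _ _] := gP _ Vu u1.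
  have -> : \sum_i d i n *: e i = 2^-1 ^+ n *: g (u n).
    have gS : (index (g (u n)) S < size S)%N by rewrite index_mem mem_undup.
    rewrite (bigD1 (Ordinal gS))//= big1 ?addr0.
      by rewrite /d /e/= nth_index ?mem_undup// eqxx mulr1.
    move=> i ine; rewrite /d; case: eqP => [ge|_]; last by rewrite mulr0 scale0r.
    case/negP: ine; apply/eqP/val_inj => /=.
    by rewrite ge /e index_uniq ?undup_uniq.
  rewrite uS scalerA exprSr -mulrA mulVf// mulr1 -scalerDr.
  by rewrite addrC subrK.
have cd i : cvgn (series (d i)).
  apply: (@series_le_cvg _ _ (geometric 1 2^-1)).
  - by move=> n; rewrite /d mulr_ge0// exprn_ge0// invr_ge0.
  - by move=> n; rewrite /= mul1r exprn_ge0// invr_ge0.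
  - by move=> n; rewrite /d /= mul1r ler_piMr ?exprn_ge0 ?invr_ge0// ?lern1// leq_b1.
  - by apply: is_cvg_geometric_series; rewrite ger0_norm ?invr_ge0// invf_lt1 ?ltr1n.
exists (fun i => limn (series (d i))).
have tail : (fun n => 2^-1 ^+ n *: u n) @ \oo --> (0 : E).
  apply/norm_cvg0P; apply: (@squeeze_cvgr _ _ _ _ (cst 0) (fun n => 2^-1 ^+ n)).
  - apply: nearW => n; rewrite normr_ge0/= normrZ normrX ger0_norm ?invr_ge0//.
    by rewrite ler_piMr ?exprn_ge0 ?invr_ge0//; case: (uP n).
  - exact: cvg_cst.
  - by apply: cvg_expr; rewrite ger0_norm ?invr_ge0// invf_lt1 ?ltr1n.
have sums : (fun n => \sum_i series (d i) n *: e i) @ \oo -->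
    \sum_i limn (series (d i)) *: e i.
  by apply: cvg_big => [|i _]; [exact: add_continuous|apply: cvgZr_tmp; exact: cd].
have := cvgD sums tail; rewrite addr0.
rewrite (_ : _ + _ = cst v); last by apply/funext => n; rewrite [RHS](partial n).
move=> /(_ _)/(cvg_lim (@norm_hausdorff R E)) <-.
by rewrite lim_cst//; exact: norm_hausdorff.
Qed.

(** If [T] were bounded below on [V], then [T] restricted to [V] would have a
    Lipschitz inverse, and a finite cover of the relatively compact image of
    the unit ball of [V] would pull back to a finite [2^-1]-net of that ball,
    which [half_net_finitely_spanned] forbids. *)
Lemma compact_operator_small (R : realType) (E F : normedModType R)
    (T : {linear E -> F}) (V : set E) (eta : R) :
  compact_operator T -> (forall a x y, V x -> V y -> V (a *: x + y)) ->
  ~ finitely_spanned V -> 0 < eta ->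
  exists u, [/\ V u, `|u| = 1 & `|T u| <= eta].
Proof.
move=> cT Vlin infV eta0; apply: contrapT => nou; apply: infV.
have below w : V w -> eta * `|w| <= `|T w|.
  move=> Vw; have [->|w0] := eqVneq w 0; first by rewrite normr0 mulr0.
  rewrite leNgt; apply/negP => Tw; apply: nou.
  exists (`|w|^-1 *: w).
  have V0 : V 0 by rewrite -(addNr w) -scaleN1r; exact: Vlin.
  split.
  - by rewrite -[_ *: w]addr0; exact: Vlin.
  - by rewrite normrZ normfV normr_id mulVf// normr_eq0.
  - rewrite linearZ normrZ normfV normr_id ler_pdivrMl ?normr_gt0//.
    by rewrite mulrC ltW.
pose B := V `&` [set x | `|x| <= 1].
have : bounded_set B.
  by exists 1; split => // M M1 x [_ /= x1]; exact: le_trans x1 (ltW M1).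
move=> /cT; rewrite precompactE compact_cover.
move=> /(_ E B (fun u => ball (T u) (eta / 2)))[].
- by move=> i _; exact: ball_open.
- move=> y /(_ (ball y (eta / 2))) [|_ [[w Bw <-] yw]].
    by apply: nbhsx_ballx; rewrite divr_gt0.
  by exists w => //; exact: ball_sym.
move=> D DB cov.
apply: (@half_net_finitely_spanned _ _ V (enum_fset D) Vlin) => v Vv v1.
have /cov[f /= fD] : closure (T @` B) (T v).
  by apply: subset_closure; exists v.
rewrite -ball_normE/= => Tfv.
have [Vf f1] : B f by apply/set_mem/DB.
exists f; split => //.
have /below : V (v - f) by rewrite addrC -scaleN1r; exact: Vlin.
rewrite linearB /= [X in _ <= X]distrC => h.
by rewrite -(ler_pM2l eta0); lra.
Qed.

(** * Continuity of convex functions, semicontinuity and coercivity *)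

(** Otherwise every open set [f > n] would be dense, and by Baire's theorem
    some point would lie in all of them. *)
Lemma lsc_bounded_ball (R : realType) (E : completeNormedModType R)
    (f : E -> R) :
  lower_semicontinuous (fun x => (f x)%:E) ->
  exists a M d, 0 < d /\ forall z, `|a - z| < d -> f z <= M.
Proof.
move=> /lower_semicontinuousP lf.
pose F (n : nat) := [set x | (n%:R%:E < (f x)%:E)%E].
have [n ndF] : exists n, ~ dense (F n).
  apply/existsNP => dF.
  have dbF : dense (\bigcap_n F n).
    by apply: Baire => i; split; [exact: lf|exact: contrapT (dF i)].
  have [||x [_ Fx]] := dbF setT; [by exists 0|exact: openT|].
  have := Fx (Num.truncn (f x)).+1 Logic.I.
  rewrite /F /= lte_fin.
  by apply/negP; rewrite -leNgt ltW// truncnS_gt.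
have [U [[a [oU Ua]] UF]] := denseNE ndF.
have /nbhs_ballP[d /= d0 dU] : nbhs a U by exact: open_nbhs_nbhs.
exists a, n%:R, d; split => // z az; rewrite leNgt; apply/negP => nz.
suff : (U `&` F n) z by rewrite UF.
by split; [apply: dU; rewrite -ball_normE|rewrite /F /= lte_fin].
Qed.

(** A bound near [a] is carried to a bound [N] near [y], since points near [y]
    are midpoints of points near [a] and of the reflection of [a] through [y].
    A bound near [y] becomes an [e]-bound near [y] by shrinking towards [y]:
    [y + h] is a combination of [y + t^-1 *: h] and [y], with weight [t] of
    order [e] on the first. *)
Lemma convex_bounded_ball_usc (R : realType) (E : normedModType R)
    (f : E -> R) (a : E) (M d : R) :
  convex_function [set: E] f -> 0 < d ->
  (forall z, `|a - z| < d -> f z <= M) ->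
  forall y e, 0 < e ->
    exists2 d', 0 < d' & forall h, `|h| < d' -> f (y + h) <= f y + e.
Proof.
move=> /convex_functionTP cf d0 fM y e e0.
(* the first argument of the maximum makes [N - f y] positive *)
pose N := Num.max (f y + e) (2^-1 * M + 2^-1 * f (2 *: y - a)).
have fN h : `|h| < d / 2 -> f (y + h) <= N.
  move=> hd; have /(cf _ (a + 2 *: h) (2 *: y - a)) : 0 <= (2^-1 : R) <= 1 by lra.
  have -> : 2^-1 *: (a + 2 *: h) + (1 - 2^-1) *: (2 *: y - a) = y + h.
    rewrite (_ : 1 - 2^-1 = 2^-1 :> R); last by lra.
    rewrite -scalerDr [_ + (_ - a)]addrC addrA subrK -scalerDr.
    by rewrite scalerA mulVf// scale1r.
  have : f (a + 2 *: h) <= M.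
    by apply: fM; rewrite opprD addNKr normrN normrZ ger0_norm//; lra.
  rewrite /N le_max => h1 h2; apply/orP; right; lra.
pose t := e / (N - f y).
have Nfy : e <= N - f y.
  by rewrite lerBrDl /N le_max lexx.
have D0 : 0 < N - f y by exact: lt_le_trans Nfy.
have t0 : 0 < t by rewrite divr_gt0.
have t1 : t <= 1 by rewrite ler_pdivrMr// mul1r.
exists (t * (d / 2)); first by rewrite mulr_gt0// divr_gt0.
move=> h hd; have /(cf t (y + t^-1 *: h) y) : 0 <= t <= 1 by rewrite ltW.
have -> : t *: (y + t^-1 *: h) + (1 - t) *: y = y + h.
  by rewrite scalerDr scalerA divff ?gt_eqF// scale1r addrAC -scalerDl subrKC scale1r.
have : f (y + t^-1 *: h) <= N.
  by apply: fN; rewrite normrZ gtr0_norm ?invr_gt0// ltr_pdivrMl.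
have : t * (N - f y) = e by rewrite divfK// gt_eqF.
nra.
Qed.

(** The missing lower bound at [z] follows from the upper bound at the
    reflection of [z] through [y]. *)
Lemma convex_usc_continuous (R : realType) (E : normedModType R)
    (f : E -> R) (y : E) :
  convex_function [set: E] f ->
  (forall e, 0 < e ->
    exists2 d, 0 < d & forall h, `|h| < d -> f (y + h) <= f y + e) ->
  {for y, continuous f}.
Proof.
move=> /convex_functionTP cf uf; apply/cvgrPdist_le => e e0.
have [d d0 fd] := uf e e0.
near=> z.
have zd : `|z - y| < d by rewrite distrC; near: z; exact: cvgr_dist_lt.
have := fd (z - y) zd; rewrite addrC subrK => fz.
have := fd (- (z - y)); rewrite normrN => /(_ zd) fz'.
have /(cf _ z (y - (z - y))) : 0 <= (2^-1 : R) <= 1 by lra.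
have -> : 2^-1 *: z + (1 - 2^-1) *: (y - (z - y)) = y.
  rewrite (_ : 1 - 2^-1 = 2^-1 :> R); last by lra.
  rewrite -scalerDr opprB addrCA [z + _]addrC subrK.
  by rewrite scalerDr -scalerDl (_ : 2^-1 + 2^-1 = 1) ?scale1r//; lra.
by rewrite ler_norml => fy; apply/andP; split; lra.
Unshelve. all: by end_near. Qed.

Lemma lsc_compact_bounded_below (R : realType) (T : topologicalType)
    (A : set T) (f : T -> R) :
  compact A -> lower_semicontinuous (fun t : subspace A => (f t)%:E) ->
  exists m, forall t, A t -> m <= f t.
Proof.
move=> /compact_near_coveringP/near_covering_withinP cA lf.
have /(_ _ +oo (fun M t => - M <= f t)) : near_covering_within A by [].
case.
  move=> x Ax.
  have [|V xV fV] := lf x (f x - 1); first by rewrite lte_fin ltrBlDr ltrDl.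
  exists ([set t : T | A t -> V t], [set M : R | - (f x - 1) <= M]) => /=.
    split; last exact: (nbhs_pinfty_ge (num_real _)).
    by move: xV; case: (nbhs_subspaceP A x).
  move=> [t M] /= [tV xM] At; have := fV t (tV At); rewrite lte_fin; lra.
move=> M [Mreal AM]; exists (- (M + 1)) => t At.
by apply: AM => //; rewrite ltrDl.
Qed.

Lemma lsc_subspace_near (R : realType) (A : set R) (f : R -> R) (a e : R) :
  lower_semicontinuous (fun t : subspace A => (f t)%:E) -> A a -> 0 < e ->
  exists2 d, 0 < d & forall t, A t -> `|a - t| < d -> f a - e < f t.
Proof.
move=> lf Aa e0.
have [|V aV fV] := lf a (f a - e); first by rewrite lte_fin ltrBlDr ltrDl.
have /nbhs_ballP[d /= d0 dV] : within A (nbhs a) V.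
  by move: aV; case: (nbhs_subspaceP A a).
exists d => // t At td; have := fV t (dV t td At).
by rewrite lte_fin.
Qed.

Lemma coercive_gt (R : realType) (E : normedModType R) (f : E -> R) (M : R) :
  coercive f -> exists K, forall x, K < `|x| -> M < f x.
Proof.
move=> /(_ [set z | M < z] (nbhs_pinfty_gt (num_real M))) [K _ KM].
by exists K => x /KM. Qed.

Lemma coercive_attains (R : realType) (E : normedModType R)
    (f : E -> R) (y : E) (v : R) :
  continuous f -> coercive f -> y != 0 -> f 0 <= v ->
  exists t, f (t *: y) = v.
Proof.
move=> fc fcoer y0 f0v.
have [K KM] := coercive_gt v fcoer.
have ny : 0 < `|y| by rewrite normr_gt0.
pose b := (`|K| + 1) / `|y|.
have b0 : 0 <= b by rewrite divr_ge0// addr_ge0.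
have fb : v < f (b *: y).
  apply: KM; rewrite normrZ ger0_norm// divfK ?gt_eqF//.
  by rewrite (le_lt_trans (ler_norm K))// ltrDl.
have [||c _ fcv] := @IVT R (fun t => f (t *: y)) 0 b v b0.
- apply: continuous_subspaceT => t.
  have ty : u *: y @[u --> t] --> t *: y by apply: cvgZr_tmp; exact: cvg_id.
  exact: cvg_comp _ _ ty (fc (t *: y)).
- by rewrite scale0r ge_min le_max f0v (ltW fb) orbT.
by exists c.
Qed.

(** * The minimax equality *)

(** The point built here is [x0 + s *: u], with [u] almost annihilated by [T].
    The order of the choices matters: [del] depends on [p] and [x0], then [s]
    on [del], and the smallness [eta] required of [T u] on [s]. *)
Lemma almost_optimal_point (R : realType) (E : completeNormedModType R)
    (T : {linear E -> E}) (phi : E -> R) (I : set R) (psi : R -> R) (r e : R) :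
  infinite_dimensional E -> (exists x : E, T x != 0) -> compact_operator T ->
  lower_semicontinuous (fun x : E => (phi x)%:E) ->
  convex_function [set: E] phi -> coercive phi ->
  compact I -> I 0 ->
  lower_semicontinuous (fun t : subspace I => (psi t)%:E) ->
  phi 0 < r -> 0 < e ->
  exists2 x, phi (T x) <= r &
    forall l, I l -> r + psi 0 - e <= phi (T x - l *: x) + psi l.
Proof.
move=> infE [x1 Tx1] cT lphi cphi coerphi cI I0 lpsi phi0r e0.
have [a [M [d [d0 phiM]]]] := lsc_bounded_ball lphi.
have uphi := convex_bounded_ball_usc cphi d0 phiM.
have phic : continuous phi.
  by move=> y; apply: convex_usc_continuous => //; exact: uphi.
pose e1 := e / 4; have e10 : 0 < e1 by rewrite divr_gt0.
pose v := Num.max (phi 0) (r - e1).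
have vr : v < r by rewrite gt_max phi0r/=; lra.
have ve : r - e1 <= v by rewrite le_max lexx orbT.
have [t tv] : exists t, phi (t *: T x1) = v.
  by apply: coercive_attains => //; rewrite le_max lexx.
pose x0 := t *: x1; pose y0 := T x0.
have phiy0 : phi y0 = v by rewrite /y0 linearZ.
have [p pphi] : exists p : {linear E -> R^o},
    forall h, p h <= phi (y0 + h) - phi y0.
  apply: linear_minorant; last by rewrite addr0 subrr.
  apply/convex_functionTP => s x y s01.
  have /convex_functionTP/(_ s (y0 + x) (y0 + y) s01) := cphi.
  rewrite !scalerDr addrACA -scalerDl addrC [s + _]addrC subrK scale1r addrC; lra.
have [d1 d10 psid] := lsc_subspace_near lpsi I0 e10.
have [m mpsi] := lsc_compact_bounded_below cI lpsi.
have [K Kphi] := coercive_gt (r + psi 0 - m) coerphi.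
have [d2 d20 phid] : exists2 d', 0 < d' &
    forall h, `|h| < d' -> phi (y0 + h) <= r.
  have [|d' d'0 h] := uphi y0 (r - v); first by rewrite subr_gt0.
  by exists d' => // z zd; apply: le_trans (h z zd) _; rewrite phiy0; lra.
(* [del] makes [l * p x0] at most [e1] whenever [|l| < del] *)
pose del := Num.min d1 (e1 / (1 + `|p x0|)).
have p1 : 0 < 1 + `|p x0| by rewrite ltr_pwDl.
have del0 : 0 < del by rewrite lt_min d10 divr_gt0.
(* [s] makes [|l *: x|] at least [|K| + |y0| + 2] whenever [|l| >= del], which
   leaves [T x - l *: x] outside the ball of radius [K], as
   [|T x| <= |y0| + 1] *)
pose s := `|x0| + (`|K| + `|y0| + 2) / del.
have s0 : 0 < s by rewrite ltr_wpDl// divr_gt0// ltr_wpDl.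
pose eta := Num.min 1 (d2 / 2) / s.
have eta0 : 0 < eta by rewrite divr_gt0// lt_min ltr01 divr_gt0.
pose W : set E := [set: E] `&` [set x | p x = 0].
pose V := W `&` [set x | (p \o T) x = 0].
have [u [[[_ pu] pTu] u1 Tu]] : exists u, [/\ V u, `|u| = 1 & `|T u| <= eta].
  have lin1 b x y : W x -> W y -> W (b *: x + y).
    by move=> [_ /= px] [_ /= py]; split => //=; rewrite linearP px py scaler0 addr0.
  apply: compact_operator_small => //.
    move=> b x y [x1' /= x2'] [y1' /= y2']; split; first exact: lin1.
    by rewrite /= !linearP x2' y2' scaler0 addr0.
  move=> /(finitely_spanned_ker lin1) /finitely_spanned_ker h; apply: infE.
  have [//|n [f fE]] := h; exists n, f => x; exact: fE.
have sTu1 : `|s *: T u| <= Num.min 1 (d2 / 2).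
  by rewrite normrZ gtr0_norm// mulrC -ler_pdivlMr.
move: sTu1; rewrite le_min => /andP[sTu1 sTu2].
pose x := x0 + s *: u.
have Tx : T x = y0 + s *: T u by rewrite /x linearD [T (s *: u)]linearZ.
exists x; first by rewrite Tx; apply: phid; lra.
move=> l Il; have [ld|ld] := ltP `|l| del.
- have psil : psi 0 - e1 < psi l.
    apply: psid => //; rewrite sub0r normrN.
    by apply: lt_le_trans ld _; rewrite ge_min lexx.
  have -> : T x - l *: x = y0 + (s *: T u - l *: x) by rewrite Tx addrA.
  have := pphi (s *: T u - l *: x).
  have -> : p (s *: T u - l *: x) = - (l * p x0).
    rewrite linearB [p (s *: _)]linearZ [p (l *: _)]linearZ.
    rewrite /x linearD [p (s *: u)]linearZ.
    by move: pu pTu => /= -> ->; rewrite !scaler0 addr0 sub0r.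
  have : `|l * p x0| <= e1.
    rewrite normrM (le_trans (ler_wpM2r _ (ltW ld)))//.
    rewrite -[leRHS](divfK (lt0r_neq0 p1)); apply: ler_pM => //.
    - exact: ltW.
    - by rewrite ge_min lexx orbT.
    - by rewrite lerDr.
  have := ler_norm (l * p x0).
  rewrite phiy0 (_ : e = 4 * e1); last by rewrite /e1; lra.
  lra.
- have := mpsi l Il.
  suff : r + psi 0 - m < phi (T x - l *: x) by lra.
  apply: Kphi.
  have lx : `|K| + `|y0| + 2 <= `|l *: x|.
    rewrite normrZ -(@divfK _ del _ (`|K| + `|y0| + 2)) ?gt_eqF// mulrC.
    apply: ler_pM => //; first by rewrite ltW.
      by rewrite divr_ge0 ?ltW// ltr_wpDl.
    have := lerB_dist (s *: u) (- x0).
    rewrite opprK normrN [s *: u + _]addrC -/x normrZ u1 mulr1 gtr0_norm//.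
    by rewrite {1}/s; lra.
  have := lerB_dist (l *: x) (T x); rewrite distrC.
  have := ler_normD y0 (s *: T u); rewrite -Tx.
  have := ler_norm K; lra.
Qed.

Unset Implicit Arguments.
Theorem theorem2 (R : realType) (E : completeNormedModType R)
    (T : {linear E -> E}) (phi : E -> R) (I : set R) (psi : R -> R) (r : R) :
  infinite_dimensional E ->
  reflexive_space E ->
  (exists x : E, T x != 0) ->
  compact_operator T ->
  lower_semicontinuous (fun x : E => (phi x)%:E) ->
  convex_function [set: E] phi ->
  coercive phi ->
  is_interval I -> compact I -> I 0 ->
  lower_semicontinuous (fun t : subspace I => (psi t)%:E) ->
  convex_function (I : set R^o) psi ->
  phi 0 < r ->
  let X := [set x : E | phi (T x) <= r] in
  ereal_sup [set ereal_inf [set (phi (T x - l *: x) + psi l)%:E | l in I]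
            | x in X] = (r + psi 0)%:E.
Proof.
move=> infE _ nzT cT lphi cphi coerphi _ cI I0 lpsi _ phi0r X.
apply/eqP; rewrite eq_le; apply/andP; split.
  apply: ge_ereal_sup => _ [x /= Xx <-].
  apply: (@le_trans _ _ (phi (T x - 0 *: x) + psi 0)%:E).
    by apply: ereal_inf_lbound; exists 0.
  by rewrite scale0r subr0 lee_fin lerD2r.
apply/lee_addgt0Pr => e e0.
have [x Xx xl] :=
  almost_optimal_point infE nzT cT lphi cphi coerphi cI I0 lpsi phi0r e0.
rewrite -leeBlDr// -EFinB.
apply: le_trans (ereal_sup_ubound _); last by exists x.
by apply: le_ereal_inf_tmp => _ [l Il <-]; rewrite lee_fin; exact: xl.
Qed.
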